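(* If $\delta$ is a subtle cardinal, then the set of cardinals $\kappa$ below $\delta$ that are strongly uplifting in $V_\delta$ is stationary in $\delta$.
   Context: Work in ZFC. An inaccessible cardinal $\kappa$ is strongly uplifting if for every ordinal $\theta$ and every $A\subseteq V_\kappa$ there is an inaccessible cardinal $\gamma\geq\theta$ and a set $A^*\subseteq V_\gamma$ such that $\langle V_\kappa,\in,A\rangle\prec\langle V_\gamma,\in,A^*\rangle$ is a proper elementary extension. ''Strongly uplifting in $V_\delta$'' means that $V_\delta$ satisfies this assertion about $\kappa$. A cardinal $\delta$ is subtle if for any closed unbounded set $C\subseteq\delta$ and any sequence $\langle A_\alpha\mid\alpha\in C\rangle$ with $A_\alpha\subseteq\alpha$, there is a pair of ordinals $\alpha<\beta$ in $C$ with $A_\alpha=A_\beta\cap\alpha$. *)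

(* Defs.v *)
(* Vanilla Rocq; no library beyond the prelude is needed.

   Sets are the elements of a structure (M, ∈) satisfying the axioms of ZFC, and
   classes are arbitrary predicates on M, so that Separation and Replacement
   range over all predicates.  Aczel's type of iterative sets, modulo
   bisimulation, is such a structure.  Under these axioms omega is standard, so
   first-order formulas can be an ordinary inductive type.

   The set-theoretic notions are defined for every structure (M, ∈), and their
   quantifiers range over M.  Hence "N satisfies that x has property P" is P
   evaluated in the structure N; this is how V_delta is used below. *)

Record structure := Structure {
  carrier :> Type;
  mem : carrier -> carrier -> Prop
}.

Arguments mem {s} _ _.
Declare Scope set_theory_scope.
Notation "x '∈' y" := (mem x y) (at level 70, no associativity)
  : set_theory_scope.
Open Scope set_theory_scope.

Definition subset {M : structure} (x y : M) : Prop :=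
  forall z : M, z ∈ x -> z ∈ y.
Notation "x '⊆' y" := (subset x y) (at level 70, no associativity)
  : set_theory_scope.

Definition is_empty {M : structure} (e : M) : Prop :=
  forall z : M, ~ z ∈ e.

Definition is_upair {M : structure} (p x y : M) : Prop :=
  forall z : M, z ∈ p <-> z = x \/ z = y.

Definition is_union {M : structure} (u x : M) : Prop :=
  forall z : M, z ∈ u <-> exists y : M, y ∈ x /\ z ∈ y.

Definition is_powerset {M : structure} (p x : M) : Prop :=
  forall z : M, z ∈ p <-> z ⊆ x.

Definition is_succ {M : structure} (s x : M) : Prop :=
  forall z : M, z ∈ s <-> z ∈ x \/ z = x.

(** * ZFC *)

Record ZFC (M : structure) : Prop := {
  zfc_extensionality :
    forall x y : M, (forall z : M, z ∈ x <-> z ∈ y) -> x = y;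
  zfc_foundation :
    forall x : M, (exists y : M, y ∈ x) ->
      exists y : M, y ∈ x /\ ~ (exists z : M, z ∈ x /\ z ∈ y);
  zfc_pairing :
    forall x y : M, exists p : M, is_upair p x y;
  zfc_union :
    forall x : M, exists u : M, is_union u x;
  zfc_powerset :
    forall x : M, exists p : M, is_powerset p x;
  zfc_infinity :
    exists w : M,
      (exists e : M, is_empty e /\ e ∈ w) /\
      (forall n : M, n ∈ w -> exists s : M, is_succ s n /\ s ∈ w);
  zfc_separation :
    forall (P : M -> Prop) (a : M),
      exists b : M, forall x : M, x ∈ b <-> x ∈ a /\ P x;
  zfc_replacement :
    forall (R : M -> M -> Prop) (a : M),
      (forall x y y' : M, x ∈ a -> R x y -> R x y' -> y = y') ->
      exists b : M, forall y : M, y ∈ b <-> exists x : M, x ∈ a /\ R x y;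
  zfc_choice :
    forall a : M,
      (forall x : M, x ∈ a -> exists z : M, z ∈ x) ->
      (forall x y z : M, x ∈ a -> y ∈ a -> z ∈ x -> z ∈ y -> x = y) ->
      exists c : M, forall x : M, x ∈ a ->
        exists z : M, (z ∈ x /\ z ∈ c) /\
          forall z' : M, z' ∈ x -> z' ∈ c -> z' = z
}.

(** * Functions and cardinality *)

(* Kuratowski pairs *)
Definition is_pair {M : structure} (p x y : M) : Prop :=
  forall z : M, z ∈ p <-> is_upair z x x \/ is_upair z x y.

Definition app {M : structure} (f x y : M) : Prop :=
  exists p : M, is_pair p x y /\ p ∈ f.

Definition function_on {M : structure} (f a : M) : Prop :=
  (forall p : M, p ∈ f -> exists x y : M, is_pair p x y /\ x ∈ a) /\
  (forall x : M, x ∈ a -> exists y : M, app f x y) /\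
  (forall x y y' : M, app f x y -> app f x y' -> y = y').

Definition function_from_to {M : structure} (f a b : M) : Prop :=
  function_on f a /\ forall x y : M, app f x y -> y ∈ b.

Definition injects {M : structure} (a b : M) : Prop :=
  exists f : M, function_from_to f a b /\
    forall x x' y : M, app f x y -> app f x' y -> x = x'.

Definition equinumerous {M : structure} (a b : M) : Prop :=
  exists f : M, function_from_to f a b /\
    (forall x x' y : M, app f x y -> app f x' y -> x = x') /\
    (forall y : M, y ∈ b -> exists x : M, app f x y).

Definition card_lt {M : structure} (a b : M) : Prop :=
  injects a b /\ ~ equinumerous a b.

(** * Ordinals and cardinals *)

(* Von Neumann ordinals; well-foundedness of ∈ comes from Foundation. *)
Definition ordinal {M : structure} (a : M) : Prop :=
  (forall x : M, x ∈ a -> x ⊆ a) /\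
  (forall x y : M, x ∈ a -> y ∈ a -> x ∈ y \/ x = y \/ y ∈ x).

Definition ord_le {M : structure} (a b : M) : Prop := a ∈ b \/ a = b.

Definition limit_ordinal {M : structure} (a : M) : Prop :=
  ordinal a /\ (exists x : M, x ∈ a) /\
  (forall x : M, x ∈ a -> exists y : M, y ∈ a /\ x ∈ y).

Definition is_omega {M : structure} (w : M) : Prop :=
  limit_ordinal w /\ forall x : M, x ∈ w -> ~ limit_ordinal x.

Definition cardinal {M : structure} (k : M) : Prop :=
  ordinal k /\ forall b : M, b ∈ k -> ~ equinumerous b k.

Definition uncountable_cardinal {M : structure} (k : M) : Prop :=
  cardinal k /\ exists w : M, is_omega w /\ w ∈ k.

(* no function from a smaller ordinal is cofinal; only used for infinite k *)
Definition regular {M : structure} (k : M) : Prop :=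
  forall a f : M, a ∈ k -> function_from_to f a k ->
    exists b : M, b ∈ k /\ forall x y : M, app f x y -> y ∈ b.

Definition strong_limit {M : structure} (k : M) : Prop :=
  forall a p : M, a ∈ k -> is_powerset p a -> card_lt p k.

Definition inaccessible {M : structure} (k : M) : Prop :=
  uncountable_cardinal k /\ regular k /\ strong_limit k.

(** * The cumulative hierarchy *)

(* [inV a x] is "x ∈ V_a", by the recursion
   V_a = union over b < a of the powerset of V_b. *)
Inductive inV {M : structure} : M -> M -> Prop :=
| inV_intro (a b x : M) :
    b ∈ a -> (forall y : M, y ∈ x -> inV b y) -> inV a x.

Definition Vstruct {M : structure} (d : M) : structure :=
  {| carrier := {x : M | inV d x};
     mem := fun x y => proj1_sig x ∈ proj1_sig y |}.

(** * Elementary extensions of structures (D, ∈, A) *)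

(* de Bruijn indices; [FPred i] says that variable i lies in the predicate A *)
Inductive formula : Type :=
| FMem (i j : nat)
| FEq (i j : nat)
| FPred (i : nat)
| FNot (p : formula)
| FAnd (p q : formula)
| FEx (p : formula).

Definition scons {T : Type} (x : T) (e : nat -> T) (n : nat) : T :=
  match n with
  | O => x
  | S m => e m
  end.

Fixpoint sat {M : structure} (D : M -> Prop) (A : M) (e : nat -> M)
    (p : formula) : Prop :=
  match p with
  | FMem i j => e i ∈ e j
  | FEq i j => e i = e j
  | FPred i => e i ∈ A
  | FNot q => ~ sat D A e q
  | FAnd q r => sat D A e q /\ sat D A e r
  | FEx q => exists x : M, D x /\ sat D A (scons x e) q
  end.

Definition elementary_extension {M : structure}
    (D : M -> Prop) (A : M) (D' : M -> Prop) (A' : M) : Prop :=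
  (forall x : M, D x -> D' x) /\
  (forall (p : formula) (e : nat -> M), (forall n : nat, D (e n)) ->
    (sat D A e p <-> sat D' A' e p)).

Definition proper_elementary_extension {M : structure}
    (D : M -> Prop) (A : M) (D' : M -> Prop) (A' : M) : Prop :=
  elementary_extension D A D' A' /\ exists x : M, D' x /\ ~ D x.

(** * Strongly uplifting cardinals *)

Definition strongly_uplifting {M : structure} (k : M) : Prop :=
  inaccessible k /\
  forall t A : M, ordinal t -> (forall x : M, x ∈ A -> inV k x) ->
    exists g A' : M,
      inaccessible g /\ ord_le t g /\
      (forall x : M, x ∈ A' -> inV g x) /\
      proper_elementary_extension (inV k) A (inV g) A'.

Definition strongly_uplifting_in_V {M : structure} (d k : M) : Prop :=
  exists h : inV d k, @strongly_uplifting (Vstruct d) (exist _ k h).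

(** * Clubs, stationary sets and subtle cardinals *)

(* In the closure clause the strict inequality makes [l] a limit ordinal. *)
Definition club {M : structure} (C d : M) : Prop :=
  C ⊆ d /\
  (forall x : M, x ∈ d -> exists c : M, c ∈ C /\ ord_le x c) /\
  (forall l : M, l ∈ d -> (exists x : M, x ∈ l) ->
    (forall x : M, x ∈ l -> exists c : M, c ∈ C /\ c ∈ l /\ x ∈ c) ->
    l ∈ C).

Definition stationary {M : structure} (S : M -> Prop) (d : M) : Prop :=
  (forall x : M, S x -> x ∈ d) /\
  (forall C : M, club C d -> exists x : M, x ∈ C /\ S x).

Definition subtle {M : structure} (d : M) : Prop :=
  cardinal d /\
  forall C A : M, club C d -> function_on A C ->
    (forall a Aa : M, app A a Aa -> Aa ⊆ a) ->
    exists a b Aa Ab : M,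
      a ∈ C /\ b ∈ C /\ a ∈ b /\ app A a Aa /\ app A b Ab /\
      (forall x : M, x ∈ Aa <-> x ∈ Ab /\ x ∈ a).

(* Main.v *)
(* Subtlety makes delta a regular uncountable limit, and a greedy enumeration of
   V_delta by rank gives an injection [code : V_delta -> delta] under which each
   V_r with r < delta has bounded image.

   Suppose a club C contains no strongly uplifting cardinal of V_delta.  For
   inaccessible k in C fix a counterexample: a predicate A_k on V_k and a bound
   t_k < delta.  On the club of k in C closed under [code] and t, code into a
   subset of k the satisfaction relation of (V_k, ∈, A_k) if k is regular (closure
   under [code] then makes k inaccessible), and a cofinal map from a smaller
   ordinal if k is singular.  Subtlety gives k < l whose codes agree below k.  If
   both are singular, the cofinal map of l would be bounded by k.  If both are
   regular, then (V_k, ∈, A_k) is an elementary substructure of (V_l, ∈, A_l) and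
   l > t_k, contradicting the choice of A_k and t_k. *)

Require Import Defs.
From Stdlib Require Import Classical ClassicalEpsilon FunctionalExtensionality.
From Stdlib Require Cantor.

Section SetTheory.

Context {M : structure} (HZFC : ZFC M).

(** * Basic consequences of the axioms *)

Lemma set_ext (x y : M) : (forall z, z ∈ x <-> z ∈ y) -> x = y.
Proof. apply (zfc_extensionality M HZFC). Qed.

Lemma carrier_inhabited : inhabited M.
Proof. destruct (zfc_infinity M HZFC) as [w _]. exact (inhabits w). Qed.

Lemma separation (P : M -> Prop) (a : M) :
  exists b : M, forall x, x ∈ b <-> x ∈ a /\ P x.
Proof. apply (zfc_separation M HZFC). Qed.

Lemma image_set (F : M -> M) (a : M) :
  exists b : M, forall y, y ∈ b <-> exists x, x ∈ a /\ y = F x.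
Proof.
  apply (zfc_replacement M HZFC (fun x y => y = F x) a).
  intros x y y' _ -> ->. reflexivity.
Qed.

Lemma mem_irrefl (x : M) : ~ x ∈ x.
Proof.
  intros H.
  (* The assumption [x ∈ x] lets Separation cut the singleton of [x] out of [x] itself, and
     Foundation fails for it. *)
  destruct (separation (fun z => z = x) x) as [s Hs].
  destruct (zfc_foundation M HZFC s) as [y [Hy Hn]].
  { exists x. apply Hs. auto. }
  apply Hn. exists x. apply Hs in Hy as [_ ->]. split; [apply Hs|]; auto.
Qed.

(** * Ordinals *)

(** Foundation picks a minimal one among the members of [a] satisfying [P]; when there are none, [a]
    itself is minimal. *)
Lemma ordinal_least (P : M -> Prop) (a : M) :
  ordinal a -> P a ->
  exists b, ord_le b a /\ P b /\ forall c, c ∈ b -> ~ P c.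
Proof.
  intros [Ht _] Pa.
  destruct (separation P a) as [s Hs].
  destruct (classic (exists y, y ∈ s)) as [Hne|He].
  - destruct (zfc_foundation M HZFC s Hne) as [y [Hy Hn]].
    apply Hs in Hy as [Hya Py]. exists y. split; [now left|]. split; [exact Py|].
    intros c Hc Pc. apply Hn. exists c. split; [|exact Hc].
    apply Hs. split; [exact (Ht y Hya c Hc)|exact Pc].
  - exists a. split; [now right|]. split; [exact Pa|].
    intros c Hc Pc. apply He. exists c. apply Hs. auto.
Qed.

Lemma ordinal_mem (a b : M) : ordinal a -> b ∈ a -> ordinal b.
Proof.
  intros [Ht Htri] Hb. split.
  - intros y Hy x Hx.
    pose proof (Ht b Hb y Hy) as Hya. pose proof (Ht y Hya x Hx) as Hxa.
    destruct (Htri x b Hxa Hb) as [H|H]; [exact H|exfalso].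
    (* If [x] is not in [b], then [x], [y], [b] close a membership cycle, so the set of these three
       has no minimal element. *)
    destruct (separation (fun z => z = x \/ z = y \/ z = b) a) as [s Hs].
    assert (Is : forall z, z ∈ s <-> z = x \/ z = y \/ z = b).
    { intros z. rewrite Hs. split; [tauto|]. intros K. split; [|exact K].
      destruct K as [->|[->| ->]]; assumption. }
    destruct (zfc_foundation M HZFC s) as [z [Hz Hn]].
    { exists x. apply Is. auto. }
    apply Hn. apply Is in Hz as [->|[->| ->]].
    + destruct H as [->|H].
      * exists y. split; [apply Is; auto|exact Hy].
      * exists b. split; [apply Is; auto|exact H].
    + exists x. split; [apply Is; auto|exact Hx].
    + exists y. split; [apply Is; auto|exact Hy].
  - intros x y Hx Hy. apply Htri; eapply Ht; eauto.
Qed.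

Lemma ordinal_ind (P : M -> Prop) :
  (forall a, ordinal a -> (forall b, b ∈ a -> P b) -> P a) ->
  forall a, ordinal a -> P a.
Proof.
  intros Hstep a Ha. apply NNPP. intros Hn.
  destruct (ordinal_least (fun x => ~ P x) a Ha Hn) as [b [Hba [Hb Hl]]].
  apply Hb, Hstep.
  - destruct Hba as [Hba|Hba]; [now apply (ordinal_mem a)|now subst].
  - intros c Hc. apply NNPP. exact (Hl c Hc).
Qed.

(** Double induction: if neither ordinal has a member at or above the other, the induction
    hypotheses give both the same members. *)
Lemma ordinal_trichotomy (a b : M) :
  ordinal a -> ordinal b -> a ∈ b \/ a = b \/ b ∈ a.
Proof.
  intros Ha. revert a Ha b. apply (ordinal_ind (fun a => forall b, ordinal b -> _)).
  intros a Ha IHa. apply ordinal_ind. intros b Hb IHb.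
  destruct (classic (exists x, x ∈ a /\ ord_le b x)) as [[x [Hx Hbx]]|Hna].
  { right; right. destruct Hbx as [Hbx|Hbx]; [apply (proj1 Ha x); auto|now subst]. }
  destruct (classic (exists y, y ∈ b /\ ord_le a y)) as [[y [Hy Hay]]|Hnb].
  { left. destruct Hay as [Hay|Hay]; [apply (proj1 Hb y); auto|now subst]. }
  right; left. apply set_ext. intros z. split; intros Hz.
  - destruct (IHa z Hz b Hb) as [H|[H|H]]; [exact H| |];
      exfalso; apply Hna; exists z; (split; [exact Hz|]); [right|left]; auto.
  - destruct (IHb z Hz) as [H|[H|H]]; [| |exact H];
      exfalso; apply Hnb; exists z; (split; [exact Hz|]); [left|right]; auto.
Qed.

Lemma ordinal_trans (a b c : M) : ordinal c -> a ∈ b -> b ∈ c -> a ∈ c.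
Proof. intros [Ht _] Hab Hbc. exact (Ht b Hbc a Hab). Qed.

Lemma ord_le_lt_trans (a b c : M) : ordinal c -> ord_le a b -> b ∈ c -> a ∈ c.
Proof.
  intros Hc [H| ->] Hbc; [exact (ordinal_trans a b c Hc H Hbc)|exact Hbc].
Qed.

Lemma ord_lt_le_trans (a b c : M) : ordinal c -> a ∈ b -> ord_le b c -> a ∈ c.
Proof.
  intros Hc Hab [H| <-]; [exact (ordinal_trans a b c Hc Hab H)|exact Hab].
Qed.

Lemma ord_not_lt (a b : M) : ordinal a -> ordinal b -> ~ a ∈ b -> ord_le b a.
Proof.
  intros Ha Hb H. destruct (ordinal_trichotomy a b Ha Hb) as [K|[K|K]].
  - contradiction.
  - right. auto.
  - left. exact K.
Qed.

Lemma ord_le_not_gt (a b : M) : ordinal a -> ord_le b a -> ~ a ∈ b.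
Proof.
  intros Ha Hba Hab. apply (mem_irrefl a). exact (ord_lt_le_trans a b a Ha Hab Hba).
Qed.

Lemma subset_ord_le (a b : M) : ordinal a -> ordinal b -> a ⊆ b -> ord_le a b.
Proof.
  intros Ha Hb H. apply ord_not_lt; auto. intros K. exact (mem_irrefl b (H b K)).
Qed.

Lemma limit_above2 (k x y : M) :
  limit_ordinal k -> x ∈ k -> y ∈ k -> exists z, z ∈ k /\ x ∈ z /\ y ∈ z.
Proof.
  intros [Ho [_ Hl]] Hx Hy.
  destruct (Hl x Hx) as [x' [Hx' Hxx]]. destruct (Hl y Hy) as [y' [Hy' Hyy]].
  pose proof (ordinal_mem k x' Ho Hx') as Ox. pose proof (ordinal_mem k y' Ho Hy') as Oy.
  destruct (ordinal_trichotomy x' y' Ox Oy) as [H|[H|H]].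
  - exists y'. split; [exact Hy'|]. split; [|exact Hyy].
    exact (ordinal_trans x x' y' Oy Hxx H).
  - subst y'. eauto.
  - exists x'. split; [exact Hx'|]. split; [exact Hxx|].
    exact (ordinal_trans y y' x' Ox Hyy H).
Qed.

(** * Pairs, numerals and sequences *)

Definition upair (x y : M) : M :=
  epsilon carrier_inhabited (fun p => is_upair p x y).

Lemma upair_spec (x y : M) : is_upair (upair x y) x y.
Proof. unfold upair. apply epsilon_spec, (zfc_pairing M HZFC). Qed.

Lemma is_upair_unique (p x y : M) : is_upair p x y -> p = upair x y.
Proof.
  intros H. apply set_ext. intros z. rewrite (H z). symmetry. apply upair_spec.
Qed.

Definition opair (x y : M) : M := upair (upair x x) (upair x y).

Lemma opair_spec (x y : M) : is_pair (opair x y) x y.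
Proof.
  intros z. unfold opair. rewrite (upair_spec _ _ z). split.
  - intros [->| ->]; [left|right]; apply upair_spec.
  - intros [H|H]; [left|right]; now apply is_upair_unique.
Qed.

Lemma is_pair_unique (p x y : M) : is_pair p x y -> p = opair x y.
Proof.
  intros H. apply set_ext. intros z. rewrite (H z). symmetry. apply opair_spec.
Qed.

Lemma upair_inj_r (x y y' : M) : upair x y = upair x y' -> y = y'.
Proof.
  intros E.
  assert (H : y = x \/ y = y').
  { apply (upair_spec x y'). rewrite <- E. apply upair_spec. auto. }
  assert (H' : y' = x \/ y' = y).
  { apply (upair_spec x y). rewrite E. apply upair_spec. auto. }
  intuition congruence.
Qed.

Lemma opair_inj (x y x' y' : M) : opair x y = opair x' y' -> x = x' /\ y = y'.
Proof.
  intros E.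
  assert (Hx : x = x').
  { assert (H : upair x x = upair x' x' \/ upair x x = upair x' y').
    { apply (upair_spec (upair x' x') (upair x' y')). fold (opair x' y').
      rewrite <- E. apply upair_spec. auto. }
    assert (K : x' ∈ upair x x).
    { destruct H as [->| ->]; apply upair_spec; auto. }
    apply upair_spec in K. intuition. }
  subst x'. split; [reflexivity|]. unfold opair in E.
  apply upair_inj_r in E. now apply upair_inj_r in E.
Qed.

Lemma is_pair_inj (p x y x' y' : M) :
  is_pair p x y -> is_pair p x' y' -> x = x' /\ y = y'.
Proof.
  intros H H'. apply is_pair_unique in H. apply is_pair_unique in H'.
  apply opair_inj. congruence.
Qed.

Lemma app_opair (f x y : M) : app f x y <-> opair x y ∈ f.
Proof.
  split.
  - intros [p [Hp Hf]]. apply is_pair_unique in Hp. now subst.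
  - intros H. exists (opair x y). split; [apply opair_spec|exact H].
Qed.

Lemma graph_of (F : M -> M) (a : M) :
  exists f, function_on f a /\ forall x y, app f x y <-> x ∈ a /\ y = F x.
Proof.
  destruct (image_set (fun x => opair x (F x)) a) as [f Hf].
  assert (Happ : forall x y, app f x y <-> x ∈ a /\ y = F x).
  { intros x y. rewrite app_opair, Hf. split.
    - intros [x' [Hx' E]]. apply opair_inj in E as [-> ->]. auto.
    - intros [Hx ->]. exists x. auto. }
  exists f. split; [|exact Happ]. split; [|split].
  - intros p Hp. apply Hf in Hp as [x [Hx ->]]. exists x, (F x).
    split; [apply opair_spec|exact Hx].
  - intros x Hx. exists (F x). apply Happ. auto.
  - intros x y y' H H'. apply Happ in H as [_ ->]. apply Happ in H' as [_ ->].
    reflexivity.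
Qed.

Definition empty : M := epsilon carrier_inhabited is_empty.

Lemma empty_spec : is_empty empty.
Proof.
  unfold empty. apply epsilon_spec.
  destruct (zfc_infinity M HZFC) as [w [[e [He _]] _]]. eauto.
Qed.

Lemma is_empty_unique (e : M) : is_empty e -> e = empty.
Proof.
  intros H. apply set_ext. intros z. split; intros K.
  - destruct (H z K).
  - destruct (empty_spec z K).
Qed.

Definition succ (x : M) : M := epsilon carrier_inhabited (fun s => is_succ s x).

Lemma succ_spec (x : M) : is_succ (succ x) x.
Proof.
  unfold succ. apply epsilon_spec.
  destruct (zfc_union M HZFC (upair x (upair x x))) as [u Hu]. exists u.
  intros z. rewrite (Hu z). split.
  - intros [y [Hy Hz]]. apply upair_spec in Hy as [->| ->]; [auto|].
    apply upair_spec in Hz. tauto.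
  - intros [H| ->].
    + exists x. split; [apply upair_spec; auto|exact H].
    + exists (upair x x). split; apply upair_spec; auto.
Qed.

Lemma is_succ_unique (s x : M) : is_succ s x -> s = succ x.
Proof.
  intros H. apply set_ext. intros z. rewrite (H z). symmetry. apply succ_spec.
Qed.

Lemma succ_ordinal (x : M) : ordinal x -> ordinal (succ x).
Proof.
  intros [Ht Htri]. split.
  - intros y Hy z Hz. apply succ_spec. left.
    apply succ_spec in Hy as [Hy| ->]; [exact (Ht y Hy z Hz)|exact Hz].
  - intros y z Hy Hz. apply succ_spec in Hy. apply succ_spec in Hz.
    destruct Hy as [Hy| ->]; destruct Hz as [Hz| ->]; auto.
Qed.

(** External natural numbers as finite ordinals of [M]; they index external sequences and carry
    formula codes into [M]. *)
Fixpoint numeral (n : nat) : M :=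
  match n with
  | O => empty
  | S m => succ (numeral m)
  end.

Lemma numeral_ordinal (n : nat) : ordinal (numeral n).
Proof.
  induction n as [|n IH]; [|now apply succ_ordinal].
  split; [intros x H|intros x y H _]; destruct (empty_spec _ H).
Qed.

Lemma numeral_lt (n m : nat) : n < m -> numeral n ∈ numeral m.
Proof.
  induction 1 as [|m _ IH]; simpl; apply succ_spec; auto.
Qed.

Lemma numeral_inj (n m : nat) : numeral n = numeral m -> n = m.
Proof.
  intros E. destruct (PeanoNat.Nat.lt_trichotomy n m) as [H|[H|H]]; [|exact H|];
    apply numeral_lt in H; rewrite E in H; destruct (mem_irrefl _ H).
Qed.

Lemma numeral_mem_limit (w : M) (n : nat) : limit_ordinal w -> numeral n ∈ w.
Proof.
  intros [Ho [[x Hx] Hl]]. induction n as [|n IH]; simpl.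
  - destruct (ordinal_least (fun y => y ∈ w) x) as [b [_ [Hb Hm]]];
      [now apply (ordinal_mem w)|exact Hx|].
    rewrite <- (is_empty_unique b); [exact Hb|].
    intros c Hc. apply (Hm c Hc). exact (ordinal_trans c b w Ho Hc Hb).
  - destruct (Hl _ IH) as [y [Hy Hny]].
    pose proof (ordinal_mem w y Ho Hy) as Oy.
    apply (ord_le_lt_trans _ y w Ho); [|exact Hy].
    apply subset_ord_le; [apply succ_ordinal, numeral_ordinal|exact Oy|].
    intros z Hz. apply succ_spec in Hz as [Hz| ->]; [|exact Hny].
    exact (ordinal_trans z _ y Oy Hz Hny).
Qed.

(** The graph of an external sequence on the numerals, as a set. Whole variable assignments are
    stored this way. *)
Definition seqset (s : nat -> M) : M :=
  epsilon carrier_inhabited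
    (fun q => forall z, z ∈ q <-> exists n, z = opair (numeral n) (s n)).

Lemma seqset_spec (s : nat -> M) (z : M) :
  z ∈ seqset s <-> exists n, z = opair (numeral n) (s n).
Proof.
  revert z. unfold seqset. apply epsilon_spec.
  destruct (zfc_infinity M HZFC) as [w [[e [He Hew]] Hw]].
  assert (Hnum : forall n, numeral n ∈ w).
  { induction n as [|n IH]; simpl.
    - now rewrite <- (is_empty_unique e He).
    - destruct (Hw _ IH) as [s' [Hs' Hm]]. now rewrite <- (is_succ_unique _ _ Hs'). }
  (* The inductive set [w] may have members that are not numerals; the relation gives them no
     value. *)
  destruct (zfc_replacement M HZFC
    (fun x y => exists n, x = numeral n /\ y = opair (numeral n) (s n)) w) as [q Hq].
  - intros x y y' _ [n [En ->]] [m [Em ->]].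
    assert (n = m) by (apply numeral_inj; congruence). now subst m.
  - exists q. intros z. rewrite Hq. split.
    + intros [x [_ [n [_ ->]]]]. eauto.
    + intros [n ->]. exists (numeral n). eauto.
Qed.

Lemma seqset_inj (s s' : nat -> M) :
  seqset s = seqset s' -> forall n, s n = s' n.
Proof.
  intros E n.
  assert (H : opair (numeral n) (s n) ∈ seqset s') by
    (rewrite <- E; apply seqset_spec; eauto).
  apply seqset_spec in H as [m H]. apply opair_inj in H as [H1 H2].
  apply numeral_inj in H1. now subst m.
Qed.

(** Lets [empty] serve as a marker distinct from every coded sequence. *)
Lemma seqset_nonempty (s : nat -> M) : seqset s <> empty.
Proof.
  intros E. apply (empty_spec (opair (numeral 0) (s 0))). rewrite <- E.
  apply seqset_spec. eauto.
Qed.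

(** * The cumulative hierarchy *)

Lemma inV_iff (a x : M) :
  inV a x <-> exists b, b ∈ a /\ forall y, y ∈ x -> inV b y.
Proof.
  split.
  - intros H. inversion H; subst. eauto.
  - intros [b [Hb H]]. now apply (inV_intro a b).
Qed.

Lemma inV_mono (a b x : M) : a ⊆ b -> inV a x -> inV b x.
Proof.
  intros Hab H. apply inV_iff in H as [c [Hc H]]. apply (inV_intro b c); auto.
Qed.

Lemma inV_lt (a b x : M) : ordinal b -> a ∈ b -> inV a x -> inV b x.
Proof. intros [Ht _] Hab. apply inV_mono. exact (Ht a Hab). Qed.

Lemma inV_trans (a x y : M) : ordinal a -> inV a x -> y ∈ x -> inV a y.
Proof.
  intros Ha H Hy. apply inV_iff in H as [b [Hb H]].
  exact (inV_lt b a y Ha Hb (H y Hy)).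
Qed.

Lemma inV_subset (a x y : M) : inV a x -> y ⊆ x -> inV a y.
Proof.
  intros H Hyx. apply inV_iff in H as [b [Hb H]]. apply (inV_intro a b); auto.
Qed.

Lemma mem_inV (a b : M) : ordinal a -> b ∈ a -> inV a b.
Proof.
  intros Ha. revert a Ha b. apply (ordinal_ind (fun a => forall b, _ -> _)).
  intros a Ha IH b Hb. apply (inV_intro a b); auto.
Qed.

(** The members of [t] lie in V_b for some [b ∈ a], hence in [b] by induction, so [t] is at most
    [b]. With [mem_inV], the ordinals in V_a are exactly the members of [a]. *)
Lemma inV_ordinal_mem (a t : M) : ordinal a -> ordinal t -> inV a t -> t ∈ a.
Proof.
  intros Ha. revert a Ha t. apply (ordinal_ind (fun a => forall t, _ -> _ -> _)).
  intros a Ha IH t Ht H. apply inV_iff in H as [b [Hb H]].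
  apply (ord_le_lt_trans t b a Ha); [|exact Hb].
  apply subset_ord_le; [exact Ht|now apply (ordinal_mem a)|].
  intros y Hy. apply (IH b Hb); [now apply (ordinal_mem t)|auto].
Qed.

Lemma inV_upair_lt (a b x y p : M) :
  a ∈ b -> inV a x -> inV a y -> is_upair p x y -> inV b p.
Proof.
  intros Hab Hx Hy Hp. apply (inV_intro b a); [exact Hab|].
  intros z Hz. apply Hp in Hz as [->| ->]; assumption.
Qed.

Lemma inV_above2 (k x y : M) :
  limit_ordinal k -> inV k x -> inV k y -> exists b, b ∈ k /\ inV b x /\ inV b y.
Proof.
  intros Hk Hx Hy. pose proof (proj1 Hk) as Ok.
  apply inV_iff in Hx as [b [Hb Hx]]. apply inV_iff in Hy as [c [Hc Hy]].
  destruct (limit_above2 k b c Hk Hb Hc) as [d [Hd [Hbd Hcd]]].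
  exists d. split; [exact Hd|].
  split; [exact (inV_intro d b x Hbd Hx)|exact (inV_intro d c y Hcd Hy)].
Qed.

Lemma inV_upair (k x y p : M) :
  limit_ordinal k -> inV k x -> inV k y -> is_upair p x y -> inV k p.
Proof.
  intros Hk Hx Hy Hp. destruct (inV_above2 k x y Hk Hx Hy) as [b [Hb [Bx By]]].
  exact (inV_upair_lt b k x y p Hb Bx By Hp).
Qed.

Lemma inV_opair_inv (k x y : M) :
  ordinal k -> inV k (opair x y) -> inV k x /\ inV k y.
Proof.
  intros Hk H.
  assert (K : inV k (upair x y)).
  { apply (inV_trans k (opair x y)); [exact Hk|exact H|]. apply upair_spec. auto. }
  split; apply (inV_trans k (upair x y)); auto; apply upair_spec; auto.
Qed.

(* A cofinal sequence in [k] would give a set of rank exactly [k]. *)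
Lemma inV_seqset (k w b : M) (s : nat -> M) :
  limit_ordinal k -> limit_ordinal w -> w ∈ k -> b ∈ k ->
  (forall n, inV b (s n)) -> inV k (seqset s).
Proof.
  intros Hk Hw Hwk Hb Hs. pose proof (proj1 Hk) as Ok.
  destruct (limit_above2 k w b Hk Hwk Hb) as [c [Hc [Hwc Hbc]]].
  destruct Hk as [_ [_ Hl]].
  (* [c] bounds the ranks of the numerals and of the terms; [d] and [f] leave room for the two
     layers of a Kuratowski pair. *)
  destruct (Hl c Hc) as [d [Hd Hcd]]. destruct (Hl d Hd) as [f [Hf Hdf]].
  pose proof (ordinal_mem k c Ok Hc) as Oc.
  apply (inV_intro k f); [exact Hf|].
  intros z Hz. apply seqset_spec in Hz as [n ->].
  assert (Hn : inV c (numeral n)).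
  { apply mem_inV; [exact Oc|]. apply (ordinal_trans _ w c Oc); [|exact Hwc].
    now apply numeral_mem_limit. }
  assert (Hsn : inV c (s n)) by now apply (inV_lt b c).
  apply (inV_upair_lt d f (upair (numeral n) (numeral n)) (upair (numeral n) (s n)));
    [exact Hdf| | |apply upair_spec].
  - apply (inV_upair_lt c d (numeral n) (numeral n)); auto using upair_spec.
  - apply (inV_upair_lt c d (numeral n) (s n)); auto using upair_spec.
Qed.

(** * Class-sized forms of club, regularity and subtlety *)

Definition club_class (C : M -> Prop) (d : M) : Prop :=
  (forall x, C x -> x ∈ d) /\
  (forall x, x ∈ d -> exists c, C c /\ ord_le x c) /\
  (forall l, l ∈ d -> (exists x, x ∈ l) ->
    (forall x, x ∈ l -> exists c, C c /\ c ∈ l /\ x ∈ c) -> C l).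

(** Quantifying over external maps avoids building graphs; only the values of [F] on [a] matter. *)
Definition class_regular (k : M) : Prop :=
  forall (a : M) (F : M -> M), a ∈ k -> (forall x, x ∈ a -> F x ∈ k) ->
    exists b, b ∈ k /\ forall x, x ∈ a -> F x ∈ b.

Lemma function_from_to_class (f a b : M) :
  function_from_to f a b ->
  exists F, (forall x, x ∈ a -> F x ∈ b) /\
    forall x y, app f x y <-> x ∈ a /\ y = F x.
Proof.
  intros [[Hp [Ht Hf]] Hb].
  exists (fun x => epsilon carrier_inhabited (fun y => app f x y)).
  assert (Hs : forall x, x ∈ a ->
    app f x (epsilon carrier_inhabited (fun y => app f x y))).
  { intros x Hx. apply epsilon_spec. exact (Ht x Hx). }
  split.
  - intros x Hx. exact (Hb x _ (Hs x Hx)).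
  - intros x y. split.
    + intros H. assert (Hx : x ∈ a).
      { destruct H as [p [Hxy Hpf]]. destruct (Hp p Hpf) as [x' [y' [Hp' Hx']]].
        destruct (is_pair_inj _ _ _ _ _ Hxy Hp') as [-> _]. exact Hx'. }
      split; [exact Hx|]. exact (Hf x _ _ H (Hs x Hx)).
    + intros [Hx ->]. exact (Hs x Hx).
Qed.

Lemma class_regular_regular (k : M) : class_regular k -> regular k.
Proof.
  intros Hk a f Ha Hf. apply function_from_to_class in Hf as [F [HF Happ]].
  destruct (Hk a F Ha HF) as [b [Hb HFb]]. exists b. split; [exact Hb|].
  intros x y H. apply Happ in H as [Hx ->]. auto.
Qed.

(** A bijection from a smaller ordinal onto [k] would have a bound [c ∈ k], yet [c] is itself a
    value. *)
Lemma class_regular_cardinal (k : M) : ordinal k -> class_regular k -> cardinal k.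
Proof.
  intros Ok Hk. split; [exact Ok|]. intros b Hb [f [Hf [_ Hs]]].
  apply function_from_to_class in Hf as [F [HF Happ]].
  destruct (Hk b F Hb HF) as [c [Hc Hbd]].
  destruct (Hs c Hc) as [x H]. apply Happ in H as [Hx ->].
  exact (mem_irrefl _ (Hbd x Hx)).
Qed.

Lemma class_regular_seq (k w : M) (s : nat -> M) :
  class_regular k -> limit_ordinal w -> w ∈ k -> (forall n, s n ∈ k) ->
  exists b, b ∈ k /\ forall n, s n ∈ b.
Proof.
  intros Hk Hw Hwk Hs.
  (* Members of [w] that are not numerals would be sent to [s] at an arbitrary index, which still
     lies in [k]. *)
  destruct (Hk w (fun x => s (epsilon (inhabits O) (fun n => x = numeral n))) Hwk)
    as [b [Hb H]]; [auto|].
  exists b. split; [exact Hb|]. intros n.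
  specialize (H (numeral n) (numeral_mem_limit w n Hw)).
  rewrite <- (numeral_inj n _ (epsilon_spec (inhabits O)
    (fun m => numeral n = numeral m) (ex_intro _ n eq_refl))) in H.
  exact H.
Qed.

(** Unboundedness comes from iterating a bounding step omega times: each stage exceeds [G] on the
    previous one, and regularity keeps the supremum below [d]. *)
Lemma closure_points_club (d w : M) (G : M -> M) :
  limit_ordinal d -> class_regular d -> limit_ordinal w -> w ∈ d ->
  (forall x, x ∈ d -> G x ∈ d) -> (forall x, x ∈ d -> x ∈ G x) ->
  club_class (fun k => k ∈ d /\ w ∈ k /\ forall x, x ∈ k -> G x ∈ k) d.
Proof.
  intros Hd Hr Hw Hwd HG HxG. pose proof (proj1 Hd) as Od.
  split; [tauto|]. split.
  - intros x Hx.
    assert (Hstep : forall a, exists b, a ∈ d ->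
      b ∈ d /\ a ∈ b /\ forall z, z ∈ a -> G z ∈ b).
    { intros a. destruct (classic (a ∈ d)) as [Ha|Ha]; [|exists a; tauto].
      destruct (Hr a G Ha) as [b [Hb HGb]].
      { intros z Hz. apply HG. exact (ordinal_trans z a d Od Hz Ha). }
      destruct (limit_above2 d a b Hd Ha Hb) as [c [Hc [Hac Hbc]]].
      exists c. intros _. split; [exact Hc|]. split; [exact Hac|].
      intros z Hz. apply (ordinal_trans _ b c); auto.
      now apply (ordinal_mem d). }
    apply choice in Hstep as [nxt Hnxt].
    destruct (limit_above2 d x w Hd Hx Hwd) as [a0 [Ha0 [Hxa Hwa]]].
    set (s := fix s n := match n with O => a0 | S m => nxt (s m) end).
    assert (Hs : forall n, s n ∈ d).
    { induction n as [|n IH]; [exact Ha0|]. exact (proj1 (Hnxt _ IH)). }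
    destruct (class_regular_seq d w s Hr Hw Hwd Hs) as [b [Hb Hsb]].
    destruct (ordinal_least (fun k => forall n, s n ∈ k) b) as [k [Hkb [Hsk Hmin]]];
      [now apply (ordinal_mem d)|exact Hsb|].
    assert (Hk : k ∈ d) by exact (ord_le_lt_trans k b d Od Hkb Hb).
    pose proof (ordinal_mem d k Od Hk) as Ok.
    exists k. split; [split; [exact Hk|split]|].
    + exact (ordinal_trans w a0 k Ok Hwa (Hsk 0)).
    + intros z Hz. pose proof (ordinal_trans z k d Od Hz Hk) as Hzd.
      (* By minimality of [k], [z] is at most some stage [s n], so [G z] lies in [s (S (S n))]. *)
      apply Hmin, not_all_ex_not in Hz as [n Hn].
      apply ord_not_lt in Hn; [|now apply (ordinal_mem d)..].
      destruct (Hnxt (s n) (Hs n)) as [H1 [H2 _]].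
      destruct (Hnxt (s (S n)) (Hs (S n))) as [_ [_ H3]].
      apply (ordinal_trans _ (s (S (S n))) k Ok); [|apply Hsk].
      apply H3. exact (ord_le_lt_trans z (s n) _ (ordinal_mem d _ Od H1) Hn H2).
    + left. exact (ordinal_trans x a0 k Ok Hxa (Hsk 0)).
  - intros l Hl [x Hx] Hlim. pose proof (ordinal_mem d l Od Hl) as Ol.
    split; [exact Hl|]. split.
    + destruct (Hlim x Hx) as [c [[_ [Hwc _]] [Hc _]]].
      exact (ordinal_trans w c l Ol Hwc Hc).
    + intros y Hy. destruct (Hlim y Hy) as [c [[_ [_ HGc]] [Hc Hyc]]].
      exact (ordinal_trans _ c l Ol (HGc y Hyc) Hc).
Qed.

(** * Subtle cardinals are regular uncountable limits *)

Section Subtle.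

Context (delta : M) (Hdelta : subtle delta).

Lemma subtle_ordinal : ordinal delta.
Proof. exact (proj1 (proj1 Hdelta)). Qed.

Let Od := subtle_ordinal.

(** Separation and Replacement turn the predicates [C] and [A] into the club and the sequence that
    [subtle] expects. *)
Lemma subtle_class (C : M -> Prop) (A : M -> M -> Prop) :
  club_class C delta -> (forall a x, C a -> A a x -> x ∈ a) ->
  exists a b, C a /\ C b /\ a ∈ b /\ forall x, x ∈ a -> (A a x <-> A b x).
Proof.
  intros [Hsub [Hunb Hcl]] HA.
  destruct (separation C delta) as [c Hc].
  assert (HcC : forall x, x ∈ c <-> C x).
  { intros x. rewrite Hc. split; [tauto|auto]. }
  assert (Hset : forall a, exists s, forall x, x ∈ s <-> x ∈ a /\ A a x)
    by (intros a; apply separation).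
  apply choice in Hset as [S HS].
  destruct (graph_of S c) as [f [Hf Happ]].
  destruct (proj2 Hdelta c f) as [a [b [Aa [Ab [Ha [Hb [Hab [Ea [Eb H]]]]]]]]].
  - split; [|split].
    + intros x Hx. apply Hsub, HcC, Hx.
    + intros x Hx. destruct (Hunb x Hx) as [y [Cy Hy]]. exists y.
      split; [now apply HcC|exact Hy].
    + intros l Hl Hne Hlim. apply HcC, Hcl; [exact Hl|exact Hne|].
      intros x Hx. destruct (Hlim x Hx) as [y [Cy Hy]]. exists y.
      split; [now apply HcC|exact Hy].
  - exact Hf.
  - intros a Aa Ha x Hx. apply Happ in Ha as [_ ->]. now apply HS in Hx.
  - apply Happ in Ea as [_ ->]. apply Happ in Eb as [_ ->].
    apply HcC in Ha. apply HcC in Hb.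
    exists a, b. split; [exact Ha|]. split; [exact Hb|]. split; [exact Hab|].
    intros x Hx. specialize (H x). rewrite !HS in H.
    split; intros K; [|apply H; auto].
    apply H; auto.
Qed.

Lemma final_segment_club (a : M) :
  a ∈ delta -> limit_ordinal delta -> club_class (fun x => x ∈ delta /\ a ∈ x) delta.
Proof.
  intros Ha Hl. split; [tauto|]. split.
  - intros x Hx. destruct (limit_above2 delta x a Hl Hx Ha) as [z [Hz [Hxz Haz]]].
    exists z. split; [auto|now left].
  - intros l Hld [x Hx] Hlim. split; [exact Hld|].
    destruct (Hlim x Hx) as [c [[_ Hac] [Hcl _]]].
    exact (ordinal_trans a c l (ordinal_mem _ _ Od Hld) Hac Hcl).
Qed.

(** Subtlety for the club of all ordinals below [delta] produces a member. A largest member [x]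
    would make its singleton club, and a singleton contains no pair [a ∈ b]. *)
Lemma subtle_limit : limit_ordinal delta.
Proof.
  split; [exact Od|]. split.
  - destruct (subtle_class (fun x => x ∈ delta) (fun _ _ => False)) as [a [_ [Ha _]]];
      [|tauto|eauto].
    split; [auto|]. split; [|auto]. intros x Hx. exists x. split; [auto|now right].
  - intros x Hx. apply NNPP. intros Hmax.
    assert (Hle : forall y, y ∈ delta -> ord_le y x).
    { intros y Hy. apply ord_not_lt; [now apply (ordinal_mem delta)..|].
      intros H. apply Hmax. eauto. }
    destruct (subtle_class (fun y => y = x) (fun _ _ => False))
      as [a [b [-> [-> [H _]]]]]; [|tauto|exact (mem_irrefl _ H)].
    split; [congruence|]. split; [eauto|].
    intros l Hl [y Hy] Hlim. exfalso. destruct (Hlim y Hy) as [c [-> [Hxl _]]].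
    apply Hmax. eauto.
Qed.

(** Without a limit below [delta], every nonzero ordinal there has a largest member. The singletons
    of these violate subtlety: if [a ∈ b] shared the largest member [m], then [a] would be a member
    of [b] above [m]. *)
Lemma subtle_omega : exists w, is_omega w /\ w ∈ delta.
Proof.
  assert (Hex : exists x, x ∈ delta /\ limit_ordinal x).
  { apply NNPP. intros Hno.
    assert (Hmax : forall y, y ∈ delta -> (exists x, x ∈ y) ->
      exists m, m ∈ y /\ forall z, z ∈ y -> ~ m ∈ z).
    { intros y Hy Hne. apply NNPP. intros Hn. apply Hno. exists y.
      split; [exact Hy|]. split; [now apply (ordinal_mem delta)|].
      split; [exact Hne|]. intros x Hx. apply NNPP. intros Hn'. apply Hn.
      exists x. split; [exact Hx|]. intros z Hz Hxz. apply Hn'. eauto. }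
    destruct (subtle_class (fun x => x ∈ delta /\ exists y, y ∈ x)
      (fun y m => m ∈ y /\ forall z, z ∈ y -> ~ m ∈ z))
      as [a [b [[Ha Ha'] [[Hb _] [Hab H]]]]].
    - split; [tauto|]. split; [|tauto]. intros x Hx.
      destruct (proj2 (proj2 subtle_limit) x Hx) as [y [Hy Hxy]].
      exists y. split; [eauto|now left].
    - intros a x _ [K _]. exact K.
    - destruct (Hmax a Ha Ha') as [m [Hm Hmm]].
      destruct (proj1 (H m Hm) (conj Hm Hmm)) as [_ K]. exact (K a Hab Hm). }
  destruct Hex as [x [Hx Lx]].
  destruct (ordinal_least limit_ordinal x (proj1 Lx) Lx) as [w [Hwx [Lw Hmin]]].
  exists w. split; [split; [exact Lw|exact Hmin]|].
  exact (ord_le_lt_trans w x delta Od Hwx Hx).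
Qed.

(* For [F : a -> delta] unbounded with [a] minimal, let [idx x] be the least [i]
   with [x <= F i].  It is strictly increasing on the club of its jump points,
   and the sets [{idx c}] violate subtlety there. *)
Lemma subtle_class_regular : class_regular delta.
Proof.
  intros a F Ha. revert F.
  assert (Oa : ordinal a) by now apply (ordinal_mem delta).
  revert a Oa Ha. apply (ordinal_ind (fun a => _ -> forall F : M -> M, _ -> _)).
  intros a Oa IH Ha F HF. apply NNPP. intros Hno.
  assert (Hidx : forall x, exists i, x ∈ delta ->
    i ∈ a /\ ~ F i ∈ x /\ forall j, j ∈ i -> F j ∈ x).
  { intros x. destruct (classic (x ∈ delta)) as [Hx|Hx]; [|exists x; tauto].
    assert (Hi : exists i, i ∈ a /\ ~ F i ∈ x).
    { apply NNPP. intros Hn. apply Hno. exists x. split; [exact Hx|].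
      intros i Hi. apply NNPP. intros K. apply Hn. eauto. }
    destruct Hi as [i Hi].
    destruct (ordinal_least (fun i => i ∈ a /\ ~ F i ∈ x) i) as [j [_ [[Hj1 Hj2] Hj3]]];
      [apply (ordinal_mem a); tauto|exact Hi|].
    exists j. intros _. split; [exact Hj1|]. split; [exact Hj2|].
    intros l Hl. apply NNPP. intros K. apply (Hj3 l Hl). split; [|exact K].
    exact (ordinal_trans l j a Oa Hl Hj1). }
  apply choice in Hidx as [idx Hidx].
  assert (Oidx : forall x, x ∈ delta -> ordinal (idx x)).
  { intros x Hx. apply (ordinal_mem a); [exact Oa|]. now apply Hidx. }
  assert (Hmono : forall x y, x ∈ y -> y ∈ delta -> ord_le (idx x) (idx y)).
  { intros x y Hxy Hy. pose proof (ordinal_trans x y delta Od Hxy Hy) as Hx.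
    apply ord_not_lt; auto. intros K. apply (Hidx y Hy).
    apply (ordinal_trans _ x y); [now apply (ordinal_mem delta)| |exact Hxy].
    exact (proj2 (proj2 (Hidx x Hx)) _ K). }
  destruct (subtle_class
    (fun c => c ∈ delta /\ a ∈ c /\ forall x, x ∈ c -> idx x ∈ idx c)
    (fun c i => i = idx c)) as [c [c' [[Hc [Hac _]] [[Hc' [_ Hinc]] [Hcc' H]]]]].
  - split; [tauto|]. split.
    + intros x Hx.
      destruct (limit_above2 delta x a subtle_limit Hx Ha) as [x1 [Hx1 [Hxx Hax]]].
      destruct (Hidx x1 Hx1) as [Hi _].
      (* By minimality of [a], the values of [F] at indices below [idx x1] have a bound [b]; any [y]
         above [b] and [F (idx x1)] has a larger index. *)
      destruct (IH (idx x1) Hi (ordinal_trans _ a _ Od Hi Ha) F) as [b [Hb HFb]].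
      { intros j Hj. apply HF. exact (ordinal_trans j _ a Oa Hj Hi). }
      destruct (limit_above2 delta b (F (idx x1)) subtle_limit Hb (HF _ Hi))
        as [y [Hy [Hby HFy]]].
      assert (Hjump : idx x1 ∈ idx y).
      { apply NNPP. intros K. apply ord_not_lt in K; auto.
        apply (Hidx y Hy). destruct K as [K|K]; [|now rewrite K].
        apply (ordinal_trans _ b y); [now apply (ordinal_mem delta)|auto|exact Hby]. }
      (* The least [c] with index above [idx x1] is a jump point, since every [z ∈ c] has index at
         most [idx x1]. *)
      destruct (ordinal_least (fun y => idx x1 ∈ idx y) y) as [c [Hcy [Hc Hmin]]];
        [now apply (ordinal_mem delta)|exact Hjump|].
      assert (Hcd : c ∈ delta) by exact (ord_le_lt_trans c y delta Od Hcy Hy).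
      pose proof (ordinal_mem delta c Od Hcd) as Oc.
      assert (Hx1c : x1 ∈ c).
      { apply NNPP. intros K. apply ord_not_lt in K; [|now apply (ordinal_mem delta)|exact Oc].
        apply (ord_le_not_gt (idx x1) (idx c)); [auto| |exact Hc].
        destruct K as [K| ->]; [now apply Hmono|now right]. }
      exists c. split; [|left; exact (ordinal_trans x x1 c Oc Hxx Hx1c)].
      split; [exact Hcd|]. split; [exact (ordinal_trans a x1 c Oc Hax Hx1c)|].
      intros z Hz. pose proof (ordinal_trans z c delta Od Hz Hcd) as Hzd.
      apply (ord_le_lt_trans _ (idx x1)); [auto| |exact Hc].
      apply ord_not_lt; auto.
    + intros l Hl [x Hx] Hlim. pose proof (ordinal_mem delta l Od Hl) as Ol.
      split; [exact Hl|]. split.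
      * destruct (Hlim x Hx) as [c [[_ [Hac _]] [Hcl _]]].
        exact (ordinal_trans a c l Ol Hac Hcl).
      * intros z Hz. destruct (Hlim z Hz) as [c [[_ [_ Hinc]] [Hcl Hzc]]].
        apply (ord_lt_le_trans _ (idx c)); auto.
  - intros c i [Hc [Hac _]] ->.
    apply (ordinal_trans _ a c); [now apply (ordinal_mem delta)|now apply Hidx|exact Hac].
  (* Because [a ∈ c], the element [idx c] lies below [c], where the two singletons agree; so
     [idx c' = idx c]. *)
  - assert (K : idx c ∈ c).
    { apply (ordinal_trans _ a c); [now apply (ordinal_mem delta)|now apply Hidx|exact Hac]. }
    specialize (Hinc c Hcc'). rewrite (proj1 (H _ K) eq_refl) in Hinc at 1.
    exact (mem_irrefl _ Hinc).
Qed.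

(** * Coding elements of V_delta by ordinals below delta *)

Definition fresh (en : M -> M) (a z : M) : Prop :=
  inV delta z /\ forall y, y ∈ a -> en y <> z.

(** Minimality of rank without a rank function: each V_r containing some fresh element contains
    [z]. *)
Definition fresh_of_least_rank (en : M -> M) (a z : M) : Prop :=
  fresh en a z /\ forall r y, r ∈ delta -> fresh en a y -> inV r y -> inV r z.

Lemma fresh_of_least_rank_exists (en : M -> M) (a : M) :
  (exists z, fresh en a z) -> exists z, fresh_of_least_rank en a z.
Proof.
  intros [z Hz].
  assert (Hr : exists r, r ∈ delta /\ exists y, fresh en a y /\ inV r y).
  { destruct (proj1 (inV_iff _ _) (proj1 Hz)) as [b [Hb Hzb]].
    destruct (proj2 (proj2 subtle_limit) b Hb) as [r [Hr Hbr]].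
    exists r. split; [exact Hr|]. exists z. split; [exact Hz|].
    exact (inV_intro r b z Hbr Hzb). }
  destruct Hr as [r0 [Hr0 Hex]].
  destruct (ordinal_least (fun r => exists y, fresh en a y /\ inV r y) r0)
    as [r [Hrr [[y [Hy Hyr]] Hmin]]]; [now apply (ordinal_mem delta)|exact Hex|].
  pose proof (ord_le_lt_trans r r0 delta Od Hrr Hr0) as Hrd.
  exists y. split; [exact Hy|]. intros r' y' Hr' Hy' Hyr'.
  assert (H : ord_le r r').
  { apply ord_not_lt; [now apply (ordinal_mem delta)..|].
    intros K. apply (Hmin r' K). eauto. }
  destruct H as [H| <-]; [|exact Hyr].
  apply (inV_lt r r'); auto. now apply (ordinal_mem delta).
Qed.

(** Supports recursion by [Fix]. The guard [ordinal y] leaves other sets without predecessors, so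
    [ordinal_ind] suffices. *)
Lemma ordinal_mem_wf : well_founded (fun x y : M => ordinal y /\ x ∈ y).
Proof.
  intros y. constructor. intros x [Hy Hx].
  assert (Ox : ordinal x) by now apply (ordinal_mem y).
  clear y Hy Hx. revert x Ox. apply ordinal_ind.
  intros a _ IH. constructor. intros b [_ Hb]. auto.
Qed.

Lemma greedy_enumeration :
  exists en : M -> M, forall a, ordinal a ->
    (exists z, fresh en a z) -> fresh_of_least_rank en a (en a).
Proof.
  (* The recursor supplies values only below [a]; the default [a] elsewhere is harmless because
     [fresh] looks only at indices in [a]. *)
  set (step := fun (a : M) (rec : forall y, ordinal a /\ y ∈ a -> M) =>
    epsilon carrier_inhabited (fresh_of_least_rank
      (fun y => match excluded_middle_informative (ordinal a /\ y ∈ a) with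
                | left h => rec y h
                | right _ => a
                end) a)).
  set (en := Fix ordinal_mem_wf (fun _ => M) step).
  exists en. intros a Oa Hex.
  assert (Een : en a = step a (fun y _ => en y)).
  { unfold en at 1. rewrite Fix_eq; [reflexivity|].
    intros x f g Hfg. replace g with f; [reflexivity|].
    extensionality y. extensionality p. apply Hfg. }
  assert (Hext : forall z, fresh_of_least_rank
      (fun y => match excluded_middle_informative (ordinal a /\ y ∈ a) with
                | left _ => en y
                | right _ => a
                end) a z <-> fresh_of_least_rank en a z).
  { assert (Hf : forall z, fresh
      (fun y => match excluded_middle_informative (ordinal a /\ y ∈ a) with
                | left _ => en y
                | right _ => a
                end) a z <-> fresh en a z).
    { intros z. split; intros [Hz H]; (split; [exact Hz|]); intros y Hy;
        specialize (H y Hy); destruct (excluded_middle_informative _); tauto. }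
    intros z. unfold fresh_of_least_rank. rewrite Hf.
    split; intros [Hz H]; (split; [exact Hz|]); intros r y Hr Hy;
      apply H; auto; now apply Hf. }
  apply Hext. rewrite Een. unfold step. apply epsilon_spec.
  destruct (fresh_of_least_rank_exists en a Hex) as [z Hz].
  exists z. now apply Hext.
Qed.

(* If the enumeration never exhausts V_r, every [en c] lies in V_r, so is a subset
   of the first [b] values for a fixed [b]; the sets [{i < b | en i ∈ en c}]
   for [c > b] then violate subtlety. *)
Lemma greedy_enumeration_exhausts (en : M -> M) :
  (forall a, ordinal a -> (exists z, fresh en a z) -> fresh_of_least_rank en a (en a)) ->
  forall r, r ∈ delta ->
    exists b, b ∈ delta /\ forall z, inV r z -> exists i, i ∈ b /\ en i = z.
Proof.
  intros Hen r Hr.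
  assert (Or : ordinal r) by now apply (ordinal_mem delta).
  revert r Or Hr. apply (ordinal_ind (fun r => _ -> _)).
  intros r Or IH Hr. apply NNPP. intros Hno.
  (* As V_r is never exhausted, a fresh element of it always remains, so the choice of least rank
     stays in V_r. *)
  assert (Hf : forall a, a ∈ delta ->
    inV r (en a) /\ forall y, y ∈ a -> en y <> en a).
  { intros a Ha.
    assert (Hz : exists z, inV r z /\ forall i, i ∈ a -> en i <> z).
    { apply NNPP. intros Hn. apply Hno. exists a. split; [exact Ha|].
      intros z Hz. apply NNPP. intros K. apply Hn. exists z.
      split; [exact Hz|]. intros i Hi E. apply K. eauto. }
    destruct Hz as [z [Hzr Hz]].
    assert (Fz : fresh en a z) by (split; [exact (inV_lt r delta z Od Hr Hzr)|exact Hz]).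
    destruct (Hen a (ordinal_mem _ _ Od Ha) (ex_intro _ z Fz)) as [[_ H1] H2].
    split; [exact (H2 r z Hr Fz Hzr)|exact H1]. }
  (* Regularity of [delta] bounds the stages by which the V_s with [s ∈ r] have been enumerated. *)
  assert (Hb : exists b, b ∈ delta /\
    forall s z, s ∈ r -> inV s z -> exists i, i ∈ b /\ en i = z).
  { assert (HG : forall s, exists b, s ∈ r ->
      b ∈ delta /\ forall z, inV s z -> exists i, i ∈ b /\ en i = z).
    { intros s. destruct (classic (s ∈ r)) as [Hs|Hs]; [|exists s; tauto].
      destruct (IH s Hs (ordinal_trans s r _ Od Hs Hr)) as [b Hb]. eauto. }
    apply choice in HG as [G HG].
    destruct (subtle_class_regular r G Hr) as [b [Hb HGb]].
    { intros s Hs. now apply HG. }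
    exists b. split; [exact Hb|]. intros s z Hs Hz.
    destruct (proj2 (HG s Hs) z Hz) as [i [Hi Ei]]. exists i. split; [|exact Ei].
    exact (ordinal_trans i _ b (ordinal_mem _ _ Od Hb) Hi (HGb s Hs)). }
  destruct Hb as [b [Hb Hcov]].
  destruct (subtle_class (fun c => c ∈ delta /\ b ∈ c)
    (fun c i => i ∈ b /\ en i ∈ en c)) as [c [c' [[Hc Hbc] [[Hc' _] [Hcc' H]]]]].
  - exact (final_segment_club b Hb subtle_limit).
  - intros c i [Hc Hbc] [Hi _].
    exact (ordinal_trans i b c (ordinal_mem _ _ Od Hc) Hi Hbc).
  - assert (Hlift : forall d z, d ∈ delta -> z ∈ en d -> exists i, i ∈ b /\ en i = z).
    { intros d z Hd Hz. destruct (Hf d Hd) as [Hrd _].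
      apply inV_iff in Hrd as [s [Hs Hsd]]. eauto. }
    apply (proj2 (Hf c' Hc') c Hcc'). apply set_ext. intros z. split; intros Hz.
    + destruct (Hlift c z Hc Hz) as [i [Hi <-]].
      apply (proj1 (H i (ordinal_trans i b c (ordinal_mem _ _ Od Hc) Hi Hbc))). auto.
    + destruct (Hlift c' z Hc' Hz) as [i [Hi <-]].
      apply (proj2 (H i (ordinal_trans i b c (ordinal_mem _ _ Od Hc) Hi Hbc))). auto.
Qed.

(** [code z] is the least index at which the enumeration takes the value [z]. If V_r is exhausted
    before stage [b], its codes lie in [b]. *)
Lemma subtle_coding :
  exists code : M -> M,
    (forall z, inV delta z -> code z ∈ delta) /\
    (forall z z', inV delta z -> inV delta z' -> code z = code z' -> z = z') /\
    (forall r, r ∈ delta -> exists b, b ∈ delta /\ forall z, inV r z -> code z ∈ b).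
Proof.
  destruct greedy_enumeration as [en Hen].
  pose proof (greedy_enumeration_exhausts en Hen) as Hex.
  assert (Hcode : forall z, exists a, inV delta z ->
    a ∈ delta /\ en a = z /\ forall i, i ∈ delta -> en i = z -> ord_le a i).
  { intros z. destruct (classic (inV delta z)) as [Hz|Hz]; [|exists z; tauto].
    destruct (proj1 (inV_iff _ _) Hz) as [s [Hs Hsz]].
    destruct (proj2 (proj2 subtle_limit) s Hs) as [r [Hr Hsr]].
    destruct (Hex r Hr) as [b [Hb Hbz]].
    destruct (Hbz z (inV_intro r s z Hsr Hsz)) as [i [Hi Ei]].
    pose proof (ordinal_trans i b _ Od Hi Hb) as Hid.
    destruct (ordinal_least (fun i => en i = z) i) as [a [Hai [Ea Hmin]]];
      [now apply (ordinal_mem delta)|exact Ei|].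
    pose proof (ord_le_lt_trans a i _ Od Hai Hid) as Had.
    exists a. intros _. split; [exact Had|]. split; [exact Ea|].
    intros j Hj Ej. apply ord_not_lt; [now apply (ordinal_mem delta)..|].
    intros K. exact (Hmin j K Ej). }
  apply choice in Hcode as [code Hcode].
  exists code. split; [|split].
  - intros z Hz. now apply Hcode.
  - intros z z' Hz Hz' E. apply Hcode in Hz as [_ [<- _]].
    apply Hcode in Hz' as [_ [<- _]]. now rewrite E.
  - intros r Hr. destruct (Hex r Hr) as [b [Hb Hbz]]. exists b.
    split; [exact Hb|]. intros z Hz. destruct (Hbz z Hz) as [i [Hi Ei]].
    apply (ord_le_lt_trans _ i b); [now apply (ordinal_mem delta)| |exact Hi].
    apply Hcode; [exact (inV_lt r delta z Od Hr Hz)| |exact Ei].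
    exact (ordinal_trans i b _ Od Hi Hb).
Qed.

End Subtle.

(** * Absoluteness between M and V_d *)

Section Absoluteness.

Context (d : M) (Hd : limit_ordinal d).

Let Od : ordinal d := proj1 Hd.

Notation V := (Vstruct d).
Notation val := (@proj1_sig M (inV d)).

Lemma V_val_inj (x y : V) : val x = val y -> x = y.
Proof.
  destruct x as [x Hx], y as [y Hy]; simpl. intros ->.
  now rewrite (proof_irrelevance _ Hx Hy).
Qed.

(** Transitivity of V_d; bounded quantifiers therefore mean the same inside and outside. *)
Lemma V_mem_lift (x : M) (y : V) : x ∈ val y -> exists x' : V, val x' = x.
Proof.
  intros H. exists (exist _ x (inV_trans d (val y) x Od (proj2_sig y) H)). reflexivity.
Qed.

Lemma V_upair (p x y : V) : is_upair p x y <-> is_upair (val p) (val x) (val y).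
Proof.
  split; intros H z.
  - split.
    + intros Hz. destruct (V_mem_lift z p Hz) as [z' <-].
      apply (H z') in Hz as [->| ->]; auto.
    + intros [->| ->]; [apply (H x)|apply (H y)]; auto.
  - change (z ∈ p) with (val z ∈ val p). rewrite (H (val z)).
    split; intros [E|E]; [left|right|left|right]; try apply V_val_inj; congruence.
Qed.

Lemma V_upair_lift (p : M) (x y : V) :
  is_upair p (val x) (val y) -> exists p' : V, val p' = p.
Proof.
  intros H. assert (Hp : inV d p).
  { apply (inV_upair d (val x) (val y));
      [exact Hd|exact (proj2_sig x)|exact (proj2_sig y)|exact H]. }
  exists (exist _ p Hp). reflexivity.
Qed.

Lemma V_pair (p x y : V) : is_pair p x y <-> is_pair (val p) (val x) (val y).
Proof.
  split; intros H z.
  - split.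
    + intros Hz. destruct (V_mem_lift z p Hz) as [z' <-].
      apply (H z') in Hz. rewrite !V_upair in Hz. exact Hz.
    + intros Hz.
      assert (Hl : exists z' : V, val z' = z).
      { destruct Hz as [Hz|Hz]; exact (V_upair_lift _ _ _ Hz). }
      destruct Hl as [z' <-]. apply (H z'). rewrite !V_upair. exact Hz.
  - rewrite !V_upair. apply (H (val z)).
Qed.

Lemma V_pair_lift (p : V) (x y : M) :
  is_pair (val p) x y -> exists x' y' : V, val x' = x /\ val y' = y.
Proof.
  intros H. apply is_pair_unique in H.
  destruct (inV_opair_inv d x y Od) as [Hx Hy]; [rewrite <- H; exact (proj2_sig p)|].
  exists (exist _ x Hx), (exist _ y Hy). auto.
Qed.

Lemma V_app (f x y : V) : app f x y <-> app (val f) (val x) (val y).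
Proof.
  split.
  - intros [p [Hp Hf]]. exists (val p). split; [now apply V_pair|exact Hf].
  - intros [p [Hp Hf]]. destruct (V_mem_lift p f Hf) as [p' <-].
    exists p'. split; [now apply V_pair|exact Hf].
Qed.

Lemma V_app_lift (f : V) (x y : M) :
  app (val f) x y -> exists x' y' : V, val x' = x /\ val y' = y /\ app f x' y'.
Proof.
  intros H. assert (K := H). destruct K as [p [Hp Hf]].
  destruct (V_mem_lift p f Hf) as [p' <-].
  destruct (V_pair_lift p' x y Hp) as [x' [y' [<- <-]]].
  exists x', y'. rewrite V_app. auto.
Qed.

Lemma V_function_from_to (f a b : V) :
  function_from_to f a b <-> function_from_to (val f) (val a) (val b).
Proof.
  split; intros [[Hp [Ht Hf]] Hb]; (split; [split; [|split]|]).
  - intros p Hpf. destruct (V_mem_lift p f Hpf) as [p' <-].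
    destruct (Hp p' Hpf) as [x [y [Hxy Hx]]].
    exists (val x), (val y). split; [now apply V_pair|exact Hx].
  - intros x Hx. destruct (V_mem_lift x a Hx) as [x' <-].
    destruct (Ht x' Hx) as [y Hy]. exists (val y). now apply V_app.
  - intros x y y' H H'.
    apply V_app_lift in H as [x1 [y1 [<- [<- H]]]].
    apply V_app_lift in H' as [x2 [y2 [E [<- H']]]].
    apply V_val_inj in E as ->. f_equal. exact (Hf _ _ _ H H').
  - intros x y H. apply V_app_lift in H as [x1 [y1 [<- [<- H]]]]. exact (Hb _ _ H).
  - intros p Hpf. destruct (Hp (val p) Hpf) as [x [y [Hxy Hx]]].
    destruct (V_pair_lift p x y Hxy) as [x' [y' [<- <-]]].
    exists x', y'. split; [now apply V_pair|exact Hx].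
  - intros x Hx. destruct (Ht (val x) Hx) as [y Hy].
    apply V_app_lift in Hy as [x' [y' [E [_ H]]]].
    apply V_val_inj in E as ->. eauto.
  - intros x y y' H H'. apply V_val_inj.
    apply V_app in H. apply V_app in H'. exact (Hf _ _ _ H H').
  - intros x y H. apply V_app in H. exact (Hb _ _ H).
Qed.

(** If domain and codomain lie in V_c, the pairs in [f] lie two levels higher, which a limit [d]
    accommodates. *)
Lemma V_function_lift (f : M) (a b : V) :
  function_from_to f (val a) (val b) -> exists f' : V, val f' = f.
Proof.
  intros Hf. destruct (inV_above2 d (val a) (val b) Hd (proj2_sig a) (proj2_sig b))
    as [c [Hc [Ha Hb]]].
  pose proof (ordinal_mem d c Od Hc) as Oc.
  destruct (proj2 (proj2 Hd) c Hc) as [c1 [Hc1 Hcc1]].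
  destruct (proj2 (proj2 Hd) c1 Hc1) as [c2 [Hc2 Hcc2]].
  assert (Hfd : inV d f).
  { apply (inV_intro d c2); [exact Hc2|]. intros p Hp.
    destruct (proj1 (proj1 Hf) p Hp) as [x [y [Hxy Hx]]].
    assert (Hcx : inV c x) by exact (inV_trans c (val a) x Oc Ha Hx).
    assert (Hcy : inV c y).
    { apply (inV_trans c (val b)); [exact Oc|exact Hb|].
      apply (proj2 Hf x). exists p. auto. }
    apply is_pair_unique in Hxy as ->.
    apply (inV_upair_lt c1 c2 (upair x x) (upair x y)); [exact Hcc2| | |apply upair_spec].
    - apply (inV_upair_lt c c1 x x); auto using upair_spec.
    - apply (inV_upair_lt c c1 x y); auto using upair_spec. }
  exists (exist _ f Hfd). reflexivity.
Qed.

(** The injection is itself an element of V_d. With [V_equinumerous], which goes the opposite way,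
    this carries [card_lt] down to V_d. *)
Lemma V_injects (a b : V) : injects (val a) (val b) -> injects a b.
Proof.
  intros [f [Hf Hinj]]. destruct (V_function_lift f a b Hf) as [f' <-].
  exists f'. split; [now apply V_function_from_to|].
  intros x x' y H H'. apply V_val_inj.
  apply V_app in H. apply V_app in H'. exact (Hinj _ _ _ H H').
Qed.

Lemma V_equinumerous (a b : V) : equinumerous a b -> equinumerous (val a) (val b).
Proof.
  intros [f [Hf [Hinj Hs]]]. exists (val f).
  split; [now apply V_function_from_to|]. split.
  - intros x x' y H H'.
    apply V_app_lift in H as [x1 [y1 [<- [<- H]]]].
    apply V_app_lift in H' as [x2 [y2 [<- [E H']]]].
    apply V_val_inj in E as ->. f_equal. exact (Hinj _ _ _ H H').
  - intros y Hy. destruct (V_mem_lift y b Hy) as [y' <-].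
    destruct (Hs y' Hy) as [x Hx]. exists (val x). now apply V_app.
Qed.

Lemma V_ordinal (a : V) : ordinal a <-> ordinal (val a).
Proof.
  split; intros [Ht Htri]; split.
  - intros x Hx y Hy. destruct (V_mem_lift x a Hx) as [x' <-].
    destruct (V_mem_lift y x' Hy) as [y' <-]. exact (Ht x' Hx y' Hy).
  - intros x y Hx Hy. destruct (V_mem_lift x a Hx) as [x' <-].
    destruct (V_mem_lift y a Hy) as [y' <-].
    destruct (Htri x' y' Hx Hy) as [H|[->|H]]; auto.
  - intros x Hx y Hy. exact (Ht (val x) Hx (val y) Hy).
  - intros x y Hx Hy. destruct (Htri (val x) (val y) Hx Hy) as [H|[H|H]]; auto.
    apply V_val_inj in H. auto.
Qed.

Lemma V_limit (a : V) : limit_ordinal a <-> limit_ordinal (val a).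
Proof.
  unfold limit_ordinal. rewrite V_ordinal.
  split; intros [Ho [[x Hx] Hl]]; (split; [exact Ho|]); split.
  - exists (val x). exact Hx.
  - intros y Hy. destruct (V_mem_lift y a Hy) as [y' <-].
    destruct (Hl y' Hy) as [z Hz]. exists (val z). exact Hz.
  - destruct (V_mem_lift x a Hx) as [x' <-]. exists x'. exact Hx.
  - intros y Hy. destruct (Hl (val y) Hy) as [z [Hz Hyz]].
    destruct (V_mem_lift z a Hz) as [z' <-]. exists z'. auto.
Qed.

Lemma V_inaccessible (k : V) : inaccessible (val k) -> inaccessible k.
Proof.
  intros [[[Ok Hcard] [w [[Lw Hw] Hwk]]] [Hreg Hsl]]. split; [split|split].
  - split; [now apply V_ordinal|]. intros b Hb He.
    exact (Hcard (val b) Hb (V_equinumerous b k He)).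
  - destruct (V_mem_lift w k Hwk) as [w' <-]. exists w'. split; [|exact Hwk].
    split; [now apply V_limit|]. intros x Hx Lx. apply (Hw (val x) Hx). now apply V_limit.
  - intros a f Ha Hf. destruct (Hreg (val a) (val f) Ha) as [b [Hb H]].
    { now apply V_function_from_to. }
    destruct (V_mem_lift b k Hb) as [b' <-]. exists b'. split; [exact Hb|].
    intros x y Hxy. apply (H (val x) (val y)). now apply V_app.
  - intros a p Ha Hp. destruct (Hsl (val a) (val p) Ha) as [Hi He].
    (* The power set computed in V_d is the true one, because V_d contains every subset of its
       elements. *)
    { intros z. split.
      - intros Hz. destruct (V_mem_lift z p Hz) as [z' <-].
        apply (Hp z') in Hz. intros y Hy.
        destruct (V_mem_lift y z' Hy) as [y' <-]. exact (Hz y' Hy).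
      - intros Hz. assert (Hzd : inV d z) by exact (inV_subset d (val a) z (proj2_sig a) Hz).
        apply (proj2 (Hp (exist _ z Hzd))). intros y Hy. exact (Hz (val y) Hy). }
    split; [now apply V_injects|]. intros K. apply He. now apply V_equinumerous.
Qed.

Lemma V_inV (a x : V) : inV a x <-> inV (val a) (val x).
Proof.
  split.
  - induction 1 as [a b x Hb _ IH]. apply (inV_intro _ (val b)); [exact Hb|].
    intros y Hy. destruct (V_mem_lift y x Hy) as [y' <-]. exact (IH y' Hy).
  - intros H. remember (val a) as a0 eqn:Ea. remember (val x) as x0 eqn:Ex.
    revert a x Ea Ex. induction H as [a0 b x0 Hb _ IH]. intros a x -> ->.
    destruct (V_mem_lift b a Hb) as [b' <-]. apply (inV_intro a b'); [exact Hb|].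
    intros y Hy. apply (IH (val y)); auto.
Qed.

(** Since [k] is below [d], V_k is contained in V_d, so existential quantifiers have the same range
    in both structures. *)
Lemma V_sat (k A : V) (p : formula) (e : nat -> V) (e' : nat -> M) :
  val k ∈ d -> (forall n, e' n = val (e n)) ->
  (sat (inV k) A e p <-> sat (inV (val k)) (val A) e' p).
Proof.
  intros Hk. revert e e'.
  induction p as [i j|i j|i|p IH|p IHp q IHq|p IH]; intros e e' He; simpl.
  - now rewrite !He.
  - rewrite !He. split; [congruence|apply V_val_inj].
  - now rewrite He.
  - now rewrite (IH e e' He).
  - now rewrite (IHp e e' He), (IHq e e' He).
  - split.
    + intros [x [Hx Hs]]. exists (val x). split; [now apply V_inV|].
      apply (IH (scons x e)); [|exact Hs]. intros [|n]; [reflexivity|apply He].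
    + intros [x [Hx Hs]].
      set (x' := exist _ x (inV_lt (val k) d x Od Hk Hx) : V).
      exists x'. split; [now apply V_inV|].
      apply (IH (scons x' e) (scons x e')); [|exact Hs].
      intros [|n]; [reflexivity|apply He].
Qed.

(** The ordinals of V_d are those below [d], and a subset of V_g with [g ∈ d] belongs to V_d; so it
    suffices to consider bounds and targets below [d]. *)
Lemma strongly_uplifting_in_V_intro (k : M) :
  k ∈ d -> inaccessible k ->
  (forall t A, t ∈ d -> (forall x, x ∈ A -> inV k x) ->
    exists g A', g ∈ d /\ inaccessible g /\ ord_le t g /\
      (forall x, x ∈ A' -> inV g x) /\
      proper_elementary_extension (inV k) A (inV g) A') ->
  strongly_uplifting_in_V d k.
Proof.
  intros Hk Ik H. exists (mem_inV d k Od Hk).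
  set (k' := exist _ k (mem_inV d k Od Hk) : V).
  split; [now apply V_inaccessible|]. intros t A Ot HA.
  destruct (H (val t) (val A)) as [g [A' [Hg [Ig [Htg [HA' [[Hsub Hel] Hpr]]]]]]].
  - apply V_ordinal in Ot. exact (inV_ordinal_mem d _ Od Ot (proj2_sig t)).
  - intros x Hx. destruct (V_mem_lift x A Hx) as [x' <-].
    exact (proj1 (V_inV k' x') (HA x' Hx)).
  - set (g' := exist _ g (mem_inV d g Od Hg) : V).
    set (B := exist _ A' (inV_intro d g A' Hg HA') : V).
    exists g', B. split; [now apply V_inaccessible|]. split.
    { destruct Htg as [Htg|Htg]; [now left|right; now apply V_val_inj]. }
    split; [intros x Hx; apply V_inV, HA', Hx|]. split; [split|].
    + intros x Hx. apply V_inV, Hsub. exact (proj1 (V_inV k' x) Hx).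
    + intros p e He.
      rewrite (V_sat k' A p e (fun n => val (e n)) Hk (fun _ => eq_refl)).
      rewrite (V_sat g' B p e (fun n => val (e n)) Hg (fun _ => eq_refl)).
      apply Hel. intros n. exact (proj1 (V_inV k' (e n)) (He n)).
    + destruct Hpr as [x [Hx Hnx]].
      exists (exist _ x (inV_lt g d x Od Hg Hx)). split; [now apply V_inV|].
      intros K. apply Hnx. exact (proj1 (V_inV k' _) K).
Qed.

End Absoluteness.

(** * Coding-closed ordinals *)

(** The power set of [a ∈ k] lies inside some V_r with [r ∈ k], so [code] injects it into some
    [b ∈ k]. A bijection onto [k] would then yield an unbounded map from [b] to [k]. *)
Lemma closed_regular_inaccessible (k w : M) (code : M -> M) :
  limit_ordinal k -> is_omega w -> w ∈ k -> class_regular k ->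
  (forall z z', inV k z -> inV k z' -> code z = code z' -> z = z') ->
  (forall r, r ∈ k -> exists b, b ∈ k /\ forall z, inV r z -> code z ∈ b) ->
  inaccessible k.
Proof.
  intros Hk Hw Hwk Hr Hinj Hbd. pose proof (proj1 Hk) as Ok.
  split; [split|split].
  - now apply class_regular_cardinal.
  - eauto.
  - now apply class_regular_regular.
  - intros a p Ha Hp. destruct (proj2 (proj2 Hk) a Ha) as [r [Hrk Har]].
    destruct (Hbd r Hrk) as [b [Hb Hcode]].
    assert (Hpr : forall z, z ∈ p -> inV r z).
    { intros z Hz. apply (inV_intro r a); [exact Har|]. intros y Hy.
      apply mem_inV; [now apply (ordinal_mem k)|]. exact (proj1 (Hp z) Hz y Hy). }
    split.
    + destruct (graph_of code p) as [f [Hf Happ]]. exists f. split; [split|].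
      * exact Hf.
      * intros x y H. apply Happ in H as [Hx ->].
        apply (ordinal_trans _ b k); auto.
      * intros x x' y H H'. apply Happ in H as [Hx ->]. apply Happ in H' as [Hx' E].
        apply Hinj; [apply (inV_lt r k); auto..|exact E].
    + intros [f [Hf [_ Hs]]]. apply function_from_to_class in Hf as [F [HF Happ]].
      (* [G] undoes [code] and applies the bijection; ordinals that code no member of [p] get the
         dummy value [w]. *)
      assert (HG : forall c, exists y, y ∈ k /\ forall z, z ∈ p -> code z = c -> y = F z).
      { intros c. destruct (classic (exists z, z ∈ p /\ code z = c)) as [[z [Hz E]]|Hn].
        - exists (F z). split; [auto|]. intros z' Hz' E'. f_equal.
          apply Hinj; [apply (inV_lt r k); auto..|congruence].
        - exists w. split; [exact Hwk|]. intros z Hz E. destruct Hn. eauto. }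
      apply choice in HG as [G HG].
      destruct (Hr b G Hb) as [c [Hc HGc]]; [intros x _; apply HG|].
      destruct (Hs c Hc) as [z Hz]. apply Happ in Hz as [Hz Ez].
      specialize (HGc (code z) (Hcode z (Hpr z Hz))).
      rewrite (proj2 (HG (code z)) z Hz eq_refl), <- Ez in HGc.
      exact (mem_irrefl _ HGc).
Qed.

End SetTheory.

(** * Gödel numbering of formulas *)

Fixpoint formula_code (p : formula) : nat :=
  match p with
  | FMem i j => Cantor.to_nat (0, Cantor.to_nat (i, j))
  | FEq i j => Cantor.to_nat (1, Cantor.to_nat (i, j))
  | FPred i => Cantor.to_nat (2, i)
  | FNot q => Cantor.to_nat (3, formula_code q)
  | FAnd q r => Cantor.to_nat (4, Cantor.to_nat (formula_code q, formula_code r))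
  | FEx q => Cantor.to_nat (5, formula_code q)
  end.

Lemma cantor_inj (x y x' y' : nat) :
  Cantor.to_nat (x, y) = Cantor.to_nat (x', y') -> x = x' /\ y = y'.
Proof.
  intros E. apply (f_equal Cantor.of_nat) in E.
  rewrite !Cantor.cancel_of_to in E. now injection E.
Qed.

Lemma formula_code_inj (p q : formula) : formula_code p = formula_code q -> p = q.
Proof.
  revert q. induction p; intros [] E; cbn [formula_code] in E;
    apply cantor_inj in E as [E1 E2]; try discriminate;
    try (apply cantor_inj in E2 as [E2 E3]); f_equal; auto.
Qed.

(** * Stationarity of the strongly uplifting cardinals *)

Theorem theorem7 (M : structure) (HZFC : ZFC M) (delta : M)
    (Hdelta : subtle delta) :
  stationary
    (fun kappa : M =>
       kappa ∈ delta /\ cardinal kappa /\ strongly_uplifting_in_V delta kappa)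
    delta.
Proof.
  split; [tauto|]. intros C [HCd [HCunb HCcl]]. apply NNPP. intros Hno.
  pose proof (subtle_ordinal delta Hdelta) as Od.
  pose proof (subtle_limit HZFC delta Hdelta) as Ld.
  pose proof (subtle_class_regular HZFC delta Hdelta) as Rd.
  destruct (subtle_omega HZFC delta Hdelta) as [w [Hw Hwd]].
  destruct (subtle_coding HZFC delta Hdelta) as [code [Hcode [Hinj Hbd]]].
  (* For inaccessible [k ∈ C], [fst tA] is the bound and [snd tA] the predicate of a counterexample;
     elsewhere the pair is arbitrary. *)
  assert (Hfail : forall k, exists tA : M * M, k ∈ C -> inaccessible k ->
    fst tA ∈ delta /\ (forall x, x ∈ snd tA -> inV k x) /\
    forall g A', g ∈ delta -> inaccessible g -> ord_le (fst tA) g ->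
      (forall x, x ∈ A' -> inV g x) ->
      ~ proper_elementary_extension (inV k) (snd tA) (inV g) A').
  { intros k. apply NNPP. intros Hn. apply Hno. exists k.
    assert (Hk : k ∈ C /\ inaccessible k).
    { apply NNPP. intros K. apply Hn. exists (k, k). tauto. }
    destruct Hk as [Hk Ik]. split; [exact Hk|]. split; [auto|].
    split; [apply Ik|]. apply (strongly_uplifting_in_V_intro HZFC delta Ld); auto.
    intros t A Ht HA. apply NNPP. intros Hg. apply Hn. exists (t, A). intros _ _.
    split; [exact Ht|]. split; [exact HA|]. intros g A' Hgd Ig Htg HA' He.
    apply Hg. exists g, A'. auto. }
  apply choice in Hfail as [tA Hfail].
  (* [G x] exceeds all that closure points must absorb: the bound chosen for [x], a member of [C]
     above [x], and a bound on the codes of V_x. *)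
  assert (HG : forall x, exists y, x ∈ delta -> y ∈ delta /\ x ∈ y /\
    (x ∈ C -> inaccessible x -> fst (tA x) ∈ y) /\
    (exists c, c ∈ C /\ x ∈ c /\ c ∈ y) /\
    (exists b, b ∈ y /\ forall z, inV x z -> code z ∈ b)).
  { intros x. destruct (classic (x ∈ delta)) as [Hx|Hx]; [|exists x; tauto].
    assert (Ht : exists t, t ∈ delta /\ (x ∈ C -> inaccessible x -> fst (tA x) = t)).
    { destruct (classic (x ∈ C /\ inaccessible x)) as [[Hc Ic]|Hn].
      - exists (fst (tA x)). split; [now apply Hfail|auto].
      - exists x. tauto. }
    destruct Ht as [t [Ht Et]].
    destruct (proj2 (proj2 Ld) x Hx) as [x' [Hx' Hxx]].
    destruct (HCunb x' Hx') as [c [Hc Hxc]].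
    destruct (Hbd x Hx) as [b [Hb Hbz]].
    destruct (limit_above2 HZFC delta t c Ld Ht (HCd c Hc)) as [y1 [Hy1 [Hty Hcy]]].
    destruct (limit_above2 HZFC delta b y1 Ld Hb Hy1) as [y [Hy [Hby Hyy]]].
    assert (Oy : ordinal y) by now apply (ordinal_mem HZFC delta).
    assert (Oc : ordinal c) by (apply (ordinal_mem HZFC delta); auto).
    assert (Hcy' : c ∈ y) by exact (ordinal_trans c y1 y Oy Hcy Hyy).
    assert (Hxc' : x ∈ c) by exact (ord_lt_le_trans x x' c Oc Hxx Hxc).
    exists y. intros _. split; [exact Hy|].
    split; [exact (ordinal_trans x c y Oy Hxc' Hcy')|].
    split; [|split; eauto].
    intros Hxi Ix. rewrite (Et Hxi Ix). exact (ordinal_trans t y1 y Oy Hty Hyy). }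
  apply choice in HG as [G HG].
  pose proof (closure_points_club HZFC delta w G Ld Rd (proj1 Hw) Hwd
    (fun x Hx => proj1 (HG x Hx)) (fun x Hx => proj1 (proj2 (HG x Hx)))) as Hclub.
  set (E := fun k => k ∈ delta /\ w ∈ k /\ forall x, x ∈ k -> G x ∈ k) in Hclub.
  assert (HE : forall k, E k -> limit_ordinal k /\ k ∈ C /\
    (forall r, r ∈ k -> exists b, b ∈ k /\ forall z, inV r z -> code z ∈ b)).
  { intros k [Hk [Hwk HGk]]. pose proof (ordinal_mem HZFC delta k Od Hk) as Ok.
    assert (Hxd : forall x, x ∈ k -> x ∈ delta)
      by (intros x Hx; exact (ordinal_trans x k delta Od Hx Hk)).
    split; [split; [exact Ok|split; [eauto|]]|split].
    - intros x Hx. exists (G x). split; [auto|]. apply HG; auto.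
    - apply HCcl; [exact Hk|eauto|]. intros x Hx.
      destruct (HG x (Hxd x Hx)) as [_ [_ [_ [[c [Hc [Hxc HcG]]] _]]]].
      exists c. split; [exact Hc|]. split; [|exact Hxc].
      exact (ordinal_trans c _ k Ok HcG (HGk x Hx)).
    - intros r Hr. destruct (HG r (Hxd r Hr)) as [_ [_ [_ [_ [b [Hb Hbz]]]]]].
      exists b. split; [|exact Hbz]. exact (ordinal_trans b _ k Ok Hb (HGk r Hr)). }
  assert (HEcode : forall k z, E k -> inV k z -> code z ∈ k).
  { intros k z Ek Hz. destruct (HE k Ek) as [Lk [_ Hbk]].
    apply inV_iff in Hz as [s [Hs Hsz]].
    destruct (proj2 (proj2 Lk) s Hs) as [r [Hr Hsr]].
    destruct (Hbk r Hr) as [b [Hb Hbz]].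
    exact (ordinal_trans _ b k (proj1 Lk) (Hbz z (inV_intro r s z Hsr Hsz)) Hb). }
  assert (HEinj : forall k z z', E k -> inV k z -> inV k z' -> code z = code z' -> z = z').
  { intros k z z' [Hk _] Hz Hz'. apply Hinj; apply (inV_lt k delta); auto. }
  (* For singular [k], [fst mF] is the domain of an unbounded map into [k] and [snd mF] the map. *)
  assert (Hsing : forall k, exists mF : M * (M -> M), ~ class_regular k ->
    fst mF ∈ k /\ (forall x, x ∈ fst mF -> snd mF x ∈ k) /\
    forall b, b ∈ k -> exists x, x ∈ fst mF /\ ~ snd mF x ∈ b).
  { intros k. apply NNPP. intros Hn. apply Hn. exists (k, fun x => x). intros Hs.
    destruct Hs. intros a F Ha HF. apply NNPP. intros Hb. apply Hn.
    exists (a, F). intros _. split; [exact Ha|]. split; [exact HF|].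
    intros b Hbk. apply NNPP. intros K. apply Hb. exists b. split; [exact Hbk|].
    intros x Hx. apply NNPP. intros K'. apply K. eauto. }
  apply choice in Hsing as [mF Hsing].
  (* [sing] lists the domain, the argument and then the value forever; [enc] lists a formula number
     followed by the entire assignment. *)
  set (sing := fun k i => seqset HZFC (scons (fst (mF k)) (scons i (fun _ => snd (mF k) i)))).
  set (enc := fun p e => seqset HZFC (scons (numeral HZFC (formula_code p)) e)).
  (* The disjunct [z = empty] marks regular [k]: no [seqset] is empty. *)
  set (B := fun k z =>
    (class_regular k /\ (z = empty HZFC \/
       exists p e, (forall n : nat, inV k (e n)) /\ z = enc p e /\
         sat (inV k) (snd (tA k)) e p)) \/
    (~ class_regular k /\ exists i, i ∈ fst (mF k) /\ z = sing k i)).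
  destruct (subtle_class HZFC delta Hdelta E
    (fun k x => exists z, inV k z /\ B k z /\ x = code z)) as [k [l [Ek [El [Hkl H]]]]].
  { exact Hclub. }
  { intros k x Ek [z [Hz [_ ->]]]. now apply HEcode. }
  destruct (HE k Ek) as [Lk [Ck Bk]]. destruct (HE l El) as [Ll [Cl Bl]].
  (* Injectivity of [code] turns agreement of the coded sets below [k] into agreement of [B k] and
     [B l] on V_k. *)
  assert (HB : forall z, inV k z -> (B k z <-> B l z)).
  { intros z Hz. assert (Hzl : inV l z) by exact (inV_lt k l z (proj1 Ll) Hkl Hz).
    specialize (H _ (HEcode k z Ek Hz)). split; intros K.
    - destruct (proj1 H) as [z' [Hz' [Bz' Ez]]]; [eauto|].
      now rewrite (HEinj l z z' El Hzl Hz' Ez).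
    - destruct (proj2 H) as [z' [Hz' [Bz' Ez]]]; [eauto|].
      now rewrite (HEinj k z z' Ek Hz Hz' Ez). }
  assert (Hwk : w ∈ k) by apply Ek.
  assert (Hflag : forall m, B m (empty HZFC) <-> class_regular m).
  { intros m. split.
    - intros [[Hm _]|[_ [i [_ Ei]]]]; [exact Hm|].
      symmetry in Ei. destruct (seqset_nonempty _ _ Ei).
    - intros Hm. left. auto. }
  (* The marker [empty] lies in V_k, so [k] and [l] are both regular or both singular. *)
  assert (Hreg : class_regular k <-> class_regular l).
  { rewrite <- !Hflag. apply HB. apply (inV_intro k w); [exact Hwk|].
    intros y Hy. destruct (empty_spec HZFC y Hy). }
  destruct (classic (class_regular k)) as [Rk|Sk].
  - assert (Ik : inaccessible k) by
      (apply (closed_regular_inaccessible HZFC k w code); auto; intros z z'; now apply HEinj).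
    assert (Il : inaccessible l).
    { apply (closed_regular_inaccessible HZFC l w code); auto;
        [apply El|now apply Hreg|intros z z'; now apply HEinj]. }
    destruct (Hfail k Ck Ik) as [_ [_ Hk]]. destruct (Hfail l Cl Il) as [_ [HAl _]].
    apply (Hk l (snd (tA l))); auto.
    (* The bound [fst (tA k)] lies in [G k], and closure of [l] puts [G k] in [l]. *)
    + left. apply (ordinal_trans _ (G k)); [apply Ll| |now apply El].
      destruct Ek as [Ekd _]. now apply HG.
    + split; [split|].
      * intros x. exact (inV_lt k l x (proj1 Ll) Hkl).
      * intros p e He.
        (* Regularity bounds the ranks of the infinitely many values of [e] below [k], so the whole
           sequence is an element of V_k. *)
        assert (Hz : inV k (enc p e)).
        { assert (Hr : forall n, exists b, b ∈ k /\ inV b (e n)).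
          { intros n. destruct (inV_above2 HZFC k _ _ Lk (He n) (He n)) as [b Hb].
            exists b. tauto. }
          apply choice in Hr as [s Hs].
          destruct (class_regular_seq HZFC k w s Rk (proj1 Hw) Hwk) as [b [Hb Hsb]];
            [intros n; apply Hs|].
          destruct (limit_above2 HZFC k w b Lk Hwk Hb) as [c [Hc [Hwc Hbc]]].
          pose proof (ordinal_mem HZFC k c (proj1 Lk) Hc) as Oc.
          apply (inV_seqset HZFC k w c); auto; [apply Hw|].
          intros [|n]; simpl.
          - apply mem_inV; auto. apply (ordinal_trans _ w c); auto.
            apply numeral_mem_limit, Hw.
          - apply (inV_lt (s n) c); auto; [|apply Hs].
            exact (ordinal_trans _ b c Oc (Hsb n) Hbc). }
        (* Both the sequence coding and the formula numbering are injective, so [enc p e] determines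
           [p] and [e]. *)
        assert (Hsat : forall m, class_regular m -> (forall n, inV m (e n)) ->
          (B m (enc p e) <-> sat (inV m) (snd (tA m)) e p)).
        { intros m Rm Hm. split.
          - intros [[_ [K|[p' [e' [_ [K Hs]]]]]]|[K _]]; [|
              |contradiction].
            + destruct (seqset_nonempty _ _ K).
            + pose proof (seqset_inj _ _ _ K) as Heq.
              pose proof (formula_code_inj _ _ (numeral_inj _ _ _ (Heq 0))) as <-.
              replace e with e'; [exact Hs|].
              extensionality n. symmetry. exact (Heq (S n)).
          - intros Hs. left. split; [exact Rm|]. right. eauto. }
        rewrite <- (Hsat k Rk He), <- (Hsat l (proj1 Hreg Rk)); [now apply HB|].
        intros n. exact (inV_lt k l _ (proj1 Ll) Hkl (He n)).
      * exists k. split; [apply mem_inV; auto; apply Ll|].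
        intros K. apply (mem_irrefl HZFC k), inV_ordinal_mem; auto; apply Lk.
  - assert (Sl : ~ class_regular l) by tauto.
    destruct (Hsing k Sk) as [Hm [HF Hunb]]. destruct (Hsing l Sl) as [_ [_ Hunbl]].
    (* The sequence recording the value at [i] lies in V_k, so it is also listed for [l]; decoding
       it identifies domain and value. *)
    assert (Hmatch : forall i, i ∈ fst (mF k) ->
      fst (mF k) = fst (mF l) /\ snd (mF k) i = snd (mF l) i).
    { intros i Hi.
      assert (Hz : inV k (sing k i)).
      { destruct (limit_above2 HZFC k (fst (mF k)) (snd (mF k) i) Lk Hm (HF i Hi))
          as [c [Hc [Hmc Hic]]].
        pose proof (ordinal_mem HZFC k c (proj1 Lk) Hc) as Oc.
        apply (inV_seqset HZFC k w c); auto; [apply Hw|].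
        intros [|[|n]]; simpl; apply mem_inV; auto.
        exact (ordinal_trans i _ c Oc Hi Hmc). }
      destruct (proj1 (HB _ Hz)) as [[K _]|[_ [j [_ Ej]]]].
      - right. split; [exact Sk|eauto].
      - contradiction.
      - pose proof (seqset_inj _ _ _ Ej) as Heq. pose proof (Heq 1) as Eij.
        simpl in Eij. subst j. exact (conj (Heq 0) (Heq 2)). }
    (* Unboundedness makes the domain for [k] nonempty, so the two domains agree. A value of the map
       for [l] outside [k] would then be a value of the map for [k], which lies in [k]. *)
    destruct (Hunb w Hwk) as [i0 [Hi0 _]].
    destruct (Hmatch i0 Hi0) as [Em _].
    destruct (Hunbl k Hkl) as [i [Hi Hik]]. rewrite <- Em in Hi.
    apply Hik. rewrite <- (proj2 (Hmatch i Hi)). auto.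
Qed.
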